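(* Let $X$ be a real normed space, let $C\subseteq X$ be a convex cone, and let $E=\{e_1,e_2,\dots,e_n\}$ be a (finite) basis of $C$. If $\varphi:C\twoheadrightarrow C$ is a linear correspondence, then $$\varphi(x)=\{\,l^{-1}Al(x): A\in M_{\varphi}\,\}\qquad (0\neq x\in C),$$ and $\varphi$ is lower semicontinuous at every point of $C$.
   Context: A subset $C$ of a real normed space $X$ is a cone if $tC\subseteq C$ for every $t>0$. A linearly independent set $E$ is a basis of the cone $C$ if $C$ is exactly the set of all finite combinations $\lambda_1e_1+\dots+\lambda_ne_n$ with $e_i\in E$ and $\lambda_i\ge 0$. A correspondence $\varphi:C\twoheadrightarrow C$ assigns to each $x\in C$ a nonempty subset $\varphi(x)\subseteq C$; it is linear if $\varphi(x+y)=\varphi(x)+\varphi(y)$ and $\varphi(\lambda x)=\lambda\varphi(x)$ for all $x,y\in C$, $\lambda>0$. The linear isomorphism $l:C-C\to\mathbb{R}^n$ is defined by $l\left(\sum_{j=1}^n\lambda_je_j\right)=(\lambda_1,\dots,\lambda_n)^T$ (it maps $C$ onto $[0,+\infty)^n$). The multimatrix of $\varphi$ is $M_\varphi:=l(\varphi(e_1))\times\dots\times l(\varphi(e_n))$, regarded as the set of all real $n\times n$ matrices $A=[a_{ij}]$ whose $j$-th column lies in $l(\varphi(e_j))$ for $j=1,\dots,n$. Lower semicontinuity of $\varphi$ at $x\in C$: for every open set $U$ with $\varphi(x)\cap U\neq\emptyset$ there is a neighborhood $V$ of $x$ in $C$ such that $\varphi(z)\cap U\neq\emptyset$ for all $z\in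 V$. *)

(* Defs.v *)
From HB Require Import structures.
From mathcomp Require Import all_boot all_order all_algebra.
From mathcomp Require Import all_classical all_reals all_analysis.
From mathcomp Require Import lra.

Set Implicit Arguments.
Unset Strict Implicit.
Unset Printing Implicit Defensive.

Import Order.TTheory GRing.Theory Num.Theory.
Import numFieldNormedType.Exports.

Local Open Scope classical_set_scope.
Local Open Scope ring_scope.

Section Cones.
Context {R : realType} {X : normedModType R}.
Implicit Types (A B C E : set X) (phi : X -> set X).

Definition set_add A B : set X := [set a + b | a in A & b in B].
Definition set_sub A B : set X := [set a - b | a in A & b in B].
Definition set_scale (t : R) A : set X := [set t *: a | a in A].

(* The vertex 0 is not required to belong to a cone. *)
Definition is_cone C := forall t : R, 0 < t -> set_scale t C `<=` C.

Definition lin_indep E := forall (m : nat) (f : 'I_m -> X) (c : 'I_m -> R),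
  injective f -> (forall i, E (f i)) -> \sum_i c i *: f i = 0 ->
  forall i, c i = 0.

(* The empty combination (m = 0) is allowed, so that the empty set is a basis
   of the cone {0}. *)
Definition nonneg_combinations E : set X :=
  [set x | exists (m : nat) (f : 'I_m -> X) (c : 'I_m -> R),
     [/\ forall i, E (f i), forall i, 0 <= c i & x = \sum_i c i *: f i]].

Definition cone_basis E C := lin_indep E /\ C = nonneg_combinations E.

(* A correspondence C ->> C is encoded by a total map X -> set X, of which only
   the values at the points of C matter. *)
Definition correspondence C phi :=
  forall x, C x -> phi x !=set0 /\ phi x `<=` C.

Definition linear_correspondence C phi :=
  [/\ correspondence C phi,
      forall x y, C x -> C y -> phi (x + y) = set_add (phi x) (phi y) &
      forall (t : R) x, 0 < t -> C x -> phi (t *: x) = set_scale t (phi x)].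

Definition lsc_at C phi (x : X) := forall U : set X, open U ->
  phi x `&` U !=set0 -> \forall z \near within C (nbhs x), phi z `&` U !=set0.

Section Coordinates.
Context {n : nat} (e : 'I_n -> X).

Definition lincomb (v : 'cV[R]_n) : X := \sum_j v j 0 *: e j.

(* The isomorphism l : C - C -> R^n, extended by 0 outside C - C; its inverse
   is lincomb, see cone_coord_bij, lincombK and cone_coordK. *)
Definition cone_coord : X -> 'cV[R]_n := 'pinv_(fun=> 0) setT lincomb.

Definition multimatrix phi : set 'M[R]_n :=
  [set A | forall j, (cone_coord @` phi (e j)) (col j A)].

Lemma lincombB u v : lincomb (u - v) = lincomb u - lincomb v.
Proof.
rewrite /lincomb -sumrB; apply: eq_bigr => j _.
by rewrite !mxE scalerBl.
Qed.

Section Basis.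
Variable C : set X.
Hypotheses (e_inj : injective e) (eC : cone_basis (range e) C).

Lemma lincomb_inj : injective lincomb.
Proof.
move=> u v uv; apply/eqP; rewrite -subr_eq0; apply/eqP/colP => j.
have := lincombB u v; rewrite uv subrr => uv0; rewrite [RHS]mxE.
by apply: (eC.1 n e (fun j => (u - v) j 0)) => // i; exists i.
Qed.

Lemma lincombK : cancel lincomb cone_coord.
Proof.
by move=> v; apply: pinvKV => [x y _ _|]; [exact: lincomb_inj|exact: in_setT].
Qed.

Lemma cone_lincombP x :
  C x <-> exists2 v : 'cV[R]_n, forall j, 0 <= v j 0 & x = lincomb v.
Proof.
rewrite eC.2; split=> [[m [f [c [fE c0 ->]]]]|[v v0 ->]]; last first.
  by exists n, e, (fun j => v j 0); split=> // i; exists i.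
have /choice[g gE] : forall i, exists j, e j = f i.
  by move=> i; have [j _ ej] := fE i; exists j.
exists (\col_j \sum_(i | g i == j) c i) => [j|].
  by rewrite mxE; apply: sumr_ge0.
rewrite /lincomb (partition_big g xpredT)//=; apply: eq_bigr => j _.
rewrite mxE scaler_suml; apply: eq_bigr => i /eqP <-.
by rewrite gE.
Qed.

Lemma range_lincomb : range lincomb = set_sub C C.
Proof.
apply/seteqP; split=> [_ [v _ <-]|_ [x /cone_lincombP[u _ ->]
    [y /cone_lincombP[v _ ->] <-]]]; last by exists (u - v); rewrite ?lincombB.
exists (lincomb (\col_j Num.max (v j 0) 0)).
  by apply/cone_lincombP; eexists => // j; rewrite mxE le_max lexx orbT.
exists (lincomb (\col_j Num.max (- v j 0) 0)).
  by apply/cone_lincombP; eexists => // j; rewrite mxE le_max lexx orbT.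
rewrite -lincombB; congr lincomb; apply/colP => j; rewrite !mxE.
by case: (leP (v j 0) 0); case: (leP (- v j 0) 0);
  move=> ? ?; lra.
Qed.

Lemma cone_coordK : {in set_sub C C, cancel cone_coord lincomb}.
Proof. by rewrite -range_lincomb; exact: pinvK. Qed.

Lemma cone_coord_bij : set_bij (set_sub C C) setT cone_coord.
Proof.
rewrite -range_lincomb; apply: injpinv_bij => x y _ _; exact: lincomb_inj.
Qed.

End Basis.
End Coordinates.
End Cones.

(* Main.v *)
Require Import Defs.
From HB Require Import structures.
From mathcomp Require Import all_boot all_order all_algebra.
From mathcomp Require Import all_classical all_reals all_analysis.

Import Order.TTheory GRing.Theory Num.Theory.
Import numFieldNormedType.Exports.

Local Open Scope classical_set_scope.
Local Open Scope ring_scope.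

(** The image of a nonzero point lincomb e v of C is computed first: splitting
    off one index with v j > 0 and adding the other positive terms, linearity
    gives that phi (lincomb e v) is the set of all lincomb a v, where a ranges
    over the selections a j in phi (e j) ([image_lincomb]).  The terms with
    v j = 0 have to be left out, because phi 0 is only some convex cone with
    phi x + phi 0 = phi x; in lincomb a v they have coefficient 0, and a j can
    be chosen for them because phi (e j) is nonempty.  The choice of a matrix A
    in the multimatrix is the choice of such a selection, the columns of A being
    the coordinates of the a j ([multimatrix_lincomb]), and this is the first
    claim.

    For the lower semicontinuity at x = lincomb e u, every y in phi x has the
    form b + lincomb a u in such a way that b + lincomb a w lies in phi z for
    all nonzero z = lincomb e w in C: for x <> 0 take b = 0 and the selection a
    that yields y; for x = 0 take b = y and any selection, as
    phi z = phi 0 + phi z.  This moving point is a Lipschitz function of z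
    ([lincomb_lipschitz]), because coordinates with respect to finitely many
    linearly independent vectors are bounded by the norm ([coord_bound]), so
    it stays in a given neighborhood of y when z is close to x. *)

(** * Coordinates in a finite-dimensional subspace *)

Section Lincomb.
Context {R : realType} {X : normedModType R} {n : nat}.
Implicit Types (e a : 'I_n -> X) (u v w : 'cV[R]_n).

Lemma lincombZ e (t : R) v : lincomb e (t *: v) = t *: lincomb e v.
Proof.
by rewrite /lincomb scaler_sumr; apply: eq_bigr => j _; rewrite mxE scalerA.
Qed.

(** Applying a matrix to the coordinates over e amounts to replacing each e j
    by the vector that column j represents. *)
Lemma lincombMl e (A : 'M[R]_n) v :
  lincomb e (A *m v) = lincomb (fun j => lincomb e (col j A)) v.
Proof.
rewrite /lincomb; under eq_bigr do rewrite mxE scaler_suml.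
rewrite exchange_big /=; apply: eq_bigr => j _.
by rewrite scaler_sumr; apply: eq_bigr => i _; rewrite mxE scalerA mulrC.
Qed.

Lemma lincomb_trmx_continuous e :
  continuous (fun r : 'rV[R]_n => lincomb e r^T).
Proof.
apply: continuous_big => [|j _ r]; first exact: add_continuous.
under eq_fun do rewrite mxE.
by apply: cvgZr_tmp; [exact: nbhs_filter|exact: coord_continuous].
Qed.

Lemma rV_sphere_compact : compact [set r : 'rV[R]_n | `|r| = 1].
Proof.
apply: bounded_closed_compact.
  by exists 1; split=> // M M1 r /= ->; exact: ltW.
apply: (preimage_closed (f := fun r : 'rV[R]_n => `|r|) (D := [set 1])).
  by move=> r _; exact: norm_continuous.
exact: closed_eq.
Qed.

Lemma le_mx_entry m p (M : 'M[R]_(m, p)) i j : `|M i j| <= `|M|.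
Proof.
rewrite [leRHS]/Num.norm /= mx_normrE; apply/bigmax_geP; right => /=.
by exists (i, j).
Qed.

(** On the compact unit sphere the norm of lincomb e is continuous and, by
    injectivity, nonzero, so it has a positive minimum; homogeneity extends the
    resulting bound from the sphere to all coordinate vectors. *)
Lemma coord_bound e : injective (lincomb e) ->
  exists2 k : R, 0 < k & forall v j, `|v j 0| <= k * `|lincomb e v|.
Proof.
move=> e_inj.
have e0 : lincomb e 0 = 0 by rewrite -(scale0r 0) lincombZ scale0r.
pose S := [set r : 'rV[R]_n | `|r| = 1].
have unitS (r : 'rV[R]_n) : r != 0 -> S (`|r|^-1 *: r).
  move=> r0; rewrite /S/= normrZ gtr0_norm ?invr_gt0 ?normr_gt0//.
  by rewrite mulVf ?normr_eq0.
suff [k k0 kP] : exists2 k : R, 0 < k &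
    forall r : 'rV[R]_n, S r -> 1 <= k * `|lincomb e r^T|.
  exists k => // v j; apply: (@le_trans _ _ `|v^T|).
    by have := le_mx_entry _ _ v^T 0 j; rewrite mxE.
  have [->|v0] := eqVneq v^T 0; first by rewrite normr0 mulr_ge0 // ltW.
  have vT0 : 0 < `|v^T| by rewrite normr_gt0.
  have := kP _ (unitS _ v0).
  rewrite linearZ /= trmxK lincombZ normrZ gtr0_norm ?invr_gt0//.
  by rewrite mulrCA ler_pdivlMl// mulr1.
(* The sphere is empty when n = 0. *)
have [/eqP S0|/set0P S0] := boolP (S == set0).
  by exists 1 => // r; rewrite S0.
have [c] := @compact_EVT_min _ _ (fun r => `|lincomb e r^T|) _ S0
  rV_sphere_compact
  (continuous_subspaceT (fun r => continuous_comp (lincomb_trmx_continuous e r)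
    (@norm_continuous _ _ _))).
rewrite inE /= => c1 cmin.
have gc0 : 0 < `|lincomb e c^T|.
  rewrite normr_gt0; apply/eqP; rewrite -e0 => /e_inj /(congr1 trmx).
  rewrite trmxK trmx0 => c0; move: c1; rewrite /S/= c0 normr0 => /eqP.
  by rewrite eq_sym oner_eq0.
exists (`|lincomb e c^T|^-1); first by rewrite invr_gt0.
by move=> r rS; rewrite ler_pdivlMl// mulr1; apply: cmin; rewrite inE.
Qed.

(** The linear map sending lincomb e u to lincomb a u is bounded, whatever the
    vectors a are, since the norm of lincomb e u bounds the coordinates u. *)
Lemma lincomb_lipschitz e a : injective (lincomb e) ->
  exists2 K : R, 0 < K & forall u v,
    `|lincomb a u - lincomb a v| <= K * `|lincomb e u - lincomb e v|.
Proof.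
move=> /coord_bound[k k0 kP].
have s0 : 0 <= \sum_j `|a j| by apply: sumr_ge0.
(* The summand 1 makes the constant positive even if all a j vanish. *)
exists (k * (1 + \sum_j `|a j|)).
  by rewrite mulr_gt0// ltr_wpDr.
move=> u v; rewrite -!lincombB; apply: (le_trans (ler_norm_sum _ _ _)).
apply: (@le_trans _ _ (\sum_j k * `|lincomb e (u - v)| * `|a j|)).
  by apply: ler_sum => j _; rewrite normrZ ler_wpM2r.
rewrite -mulr_sumr mulrAC ler_wpM2r// ler_wpM2l ?ltW//.
by rewrite ltrDr.
Qed.

End Lincomb.

(** * Images under a linear correspondence *)

Section LinearCorrespondence.
Context {R : realType} {X : normedModType R}.
Variables (C : set X) (phi : X -> set X).
Hypotheses (C_cone : is_cone C) (C_convex : convex_set C).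
Hypothesis (phi_linear : linear_correspondence C phi).

Lemma cone_scale (t : R) x : 0 < t -> C x -> C (t *: x).
Proof. by move=> t0 Cx; apply: (C_cone _ t0); exists x. Qed.

Lemma cone_add x y : C x -> C y -> C (x + y).
Proof.
move=> Cx Cy.
have h0 : 0 <= (2^-1 : R) by rewrite invr_ge0.
have h1 : (2^-1 : R) <= 1 by rewrite invf_le1// ler1n.
(* x + y is twice the midpoint of x and y. *)
have := C_convex x y (Itv01 h0 h1); rewrite !inE => /(_ Cx Cy).
move=> /(cone_scale 2 _ (ltr0Sn _ 1)).
rewrite /conv /= /unstable.onem scalerDr !scalerA mulrBr divff// mulr1.
by rewrite (_ : 2 - 1 = 1 :> R) ?scale1r// -[2]/(1 + 1) addrK.
Qed.

(** The term z keeps the equation true for the empty sum: without z the left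
    side would then be phi 0 and the right side {0}.  The coefficients are
    positive because phi (0 *: x) need not be 0 *: phi x. *)
Lemma image_add_sum (I : eqType) (x : I -> X) (t : I -> R) (s : seq I) z :
  uniq s -> {in s, forall i, 0 < t i} -> (forall i, C (x i)) -> C z ->
  phi (z + \sum_(i <- s) t i *: x i) =
  [set w + \sum_(i <- s) t i *: a i | w in phi z &
     a in [set a : I -> X | forall i, phi (x i) (a i)]].
Proof.
case: phi_linear => phiC phiD phiZ + + Cx.
elim: s z => [|i s IH] z /= => [_ _|/andP[iNs us] t0] Cz.
  have /choice[a aP] : forall i, exists y, phi (x i) y.
    by move=> i; have [[y ?] _] := phiC _ (Cx i); exists y.
  rewrite big_nil addr0; apply/seteqP; split=> [y yz|_ [w wz [b _ <-]]].
    by exists y => //; exists a => //; rewrite big_nil addr0.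
  by rewrite big_nil addr0.
have ti : 0 < t i by apply: t0; rewrite mem_head.
have ts : {in s, forall i, 0 < t i}.
  by move=> j js; apply: t0; rewrite in_cons js orbT.
rewrite big_cons addrA IH//; last by apply: cone_add => //; exact: cone_scale.
rewrite phiD//; last exact: cone_scale.
rewrite phiZ//; apply/seteqP; split=> _ [w + [a aP <-]].
  move=> [w1 w1z [_ [b bi <-] <-]].
  exists w1 => //; exists (fun j => if j == i then b else a j).
    by move=> j; case: eqP => [->|_].
  rewrite big_cons eqxx addrA; congr (_ + _).
  rewrite !big_seq; apply: eq_bigr => j js.
  by case: eqP iNs => // <-; rewrite js.
move=> wz; exists (w + t i *: a i).
  by exists w => //; exists (t i *: a i) => //; exists (a i).
by exists a => //; rewrite big_cons addrA.
Qed.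

Section Basis.
Variables (n : nat) (e : 'I_n -> X).
Implicit Types (a : 'I_n -> X) (v w : 'cV[R]_n).
Hypotheses (e_inj : injective e) (e_basis : cone_basis (range e) C).

Lemma cone_basis_mem j : C (e j).
Proof.
apply/(cone_lincombP e_basis); exists (delta_mx j 0).
  by move=> i; rewrite mxE ler0n.
rewrite /lincomb (bigD1 j)//= mxE !eqxx scale1r big1 ?addr0// => i ij.
by rewrite mxE (negbTE ij) scale0r.
Qed.

(** An index with positive coefficient supplies the initial term of
    [image_add_sum], the other such indices supply its sum, and the selected
    vectors with zero coefficient contribute nothing. *)
Lemma image_lincomb v : (forall j, 0 <= v j 0) -> lincomb e v <> 0 ->
  phi (lincomb e v) = [set lincomb a v | a in
     [set a : 'I_n -> X | forall j, phi (e j) (a j)]].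
Proof.
move=> v0 ev0.
have [j0 vj0] : exists j, v j 0 != 0.
  apply: contra_notP ev0 => /forallNP v_eq0.
  by rewrite /lincomb big1// => j _; have /negP/negPn/eqP-> := v_eq0 j;
    rewrite scale0r.
have [phiC phiD phiZ] := phi_linear.
pose s := [seq j <- index_enum 'I_n | (j != j0) && (v j 0 != 0)].
have lincombE (a : 'I_n -> X) :
    lincomb a v = v j0 0 *: a j0 + \sum_(j <- s) v j 0 *: a j.
  rewrite /lincomb (bigD1 j0)//= big_filter; congr (_ + _).
  rewrite [RHS]big_mkcondr; apply: eq_bigr => j _.
  by case: eqP => // ->; rewrite scale0r.
have pos j : v j 0 != 0 -> 0 < v j 0 by rewrite lt0r v0 => ->.
have Ce := cone_basis_mem.
rewrite lincombE image_add_sum//.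
- rewrite phiZ ?pos//; apply/seteqP; split=> [_ [_ [b bj <-] [a aP <-]]|].
    exists (fun j => if j == j0 then b else a j).
      by move=> j /=; case: eqP => [->|_].
    rewrite lincombE eqxx; congr (_ + _).
    by rewrite !big_filter; apply: eq_bigr => j /andP[/negbTE-> _].
  move=> _ [a aP <-]; exists (v j0 0 *: a j0); first by exists (a j0).
  by exists a => //; rewrite lincombE.
- by rewrite filter_uniq// index_enum_uniq.
- by move=> j; rewrite mem_filter => /andP[/andP[_ /pos]].
- by apply: cone_scale => //; exact: pos.
Qed.

(** A matrix of the multimatrix is determined by its columns, and the vectors
    that these represent are exactly the selections from the phi (e j). *)
Lemma multimatrix_lincomb v :
  [set lincomb e (A *m v) | A in multimatrix e phi] =
  [set lincomb a v | a in [set a : 'I_n -> X | forall j, phi (e j) (a j)]].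
Proof.
have coordK y : C y -> lincomb e (cone_coord e y) = y.
  by move=> /(cone_lincombP e_basis)[u _ ->]; rewrite (lincombK e_inj e_basis).
have phi_e j y : phi (e j) y -> C y.
  by have [phiC _ _] := phi_linear; exact: (phiC _ (cone_basis_mem j)).2.
apply/seteqP; split=> [_ [A AM <-]|_ [a aP <-]].
  exists (fun j => lincomb e (col j A)).
    move=> j; have [y yj <-] := AM j.
    by rewrite coordK//; exact: phi_e yj.
  by rewrite lincombMl.
exists (\matrix_(i, j) cone_coord e (a j) i 0).
  move=> j; exists (a j) => //.
  by apply/colP => i; rewrite !mxE.
rewrite lincombMl; apply: eq_bigr => j _; congr (_ *: _).
rewrite -[RHS](coordK _ (phi_e _ _ (aP j))); congr lincomb.
by apply/colP => i; rewrite !mxE.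
Qed.

(** * Lower semicontinuity *)

(** Every y in phi x extends to a selection of phi that is Lipschitz in the
    coordinates and defined at all nonzero points of C.  The point z = 0, which
    it may miss, is either x itself, where y does, or at a positive distance
    from x. *)
Lemma lsc_at_cone x : C x -> lsc_at C phi x.
Proof.
have [phiC phiD phiZ] := phi_linear.
have cP := cone_lincombP e_basis.
move=> Cx U oU [y [xy Uy]].
have [u u0 xu] := (cP x).1 Cx.
have [a [b [ybu abP]]] : exists (a : 'I_n -> X) (b : X),
    y = b + lincomb a u :> X /\
    forall w, (forall j, 0 <= w j 0) -> lincomb e w <> 0 ->
      phi (lincomb e w) (b + lincomb a w).
  have [x0|x0] := pselect (x = 0).
    have /choice[a aP] : forall j, exists y, phi (e j) y.
      move=> j; have [[y' ?] _] := phiC _ (cone_basis_mem j).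
      by exists y'.
    have uE : u = 0.
      apply: (lincomb_inj e_inj e_basis); rewrite -xu x0 /lincomb big1// => j _.
      by rewrite mxE scale0r.
    exists a, y; split.
      by rewrite uE /lincomb big1 ?addr0// => j _; rewrite mxE scale0r.
    move=> w w0 ew0; rewrite -[lincomb e w]add0r phiD; last 2 first.
    - by rewrite -x0.
    - by apply/cP; exists w.
    exists y; first by rewrite -x0.
    by exists (lincomb a w) => //; rewrite image_lincomb//; exists a.
  move: xy; rewrite xu image_lincomb//; last by rewrite -xu.
  move=> [a aP <-]; exists a, 0; split; first by rewrite add0r.
  by move=> w w0 ew0; rewrite add0r image_lincomb//; exists a.
have [K K0 KP] := lincomb_lipschitz e a (lincomb_inj e_inj e_basis).
have /nbhs_normP[/= r r0 rU] : nbhs y U by exact: open_nbhs_nbhs.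
have near_x : \forall z \near x, z = x \/ z <> 0.
  have [->|/eqP x0] := pselect (x = 0).
    by apply: nearW => z; exact: EM.
  near=> z; right; apply/eqP.
  by near: z; apply: cvgr_neq0 x0; exact: cvg_id.
rewrite near_withinE; near=> z => Cz.
have [->|zN0] : z = x \/ z <> 0 by near: z.
  by exists y.
have [w w0 zw] := (cP z).1 Cz.
exists (b + lincomb a w); split.
  by rewrite zw; apply: abP => //; rewrite -zw.
apply: rU => /=; rewrite /ball_ /= ybu opprD addrACA subrr add0r.
apply: le_lt_trans (KP _ _) _; rewrite -xu -zw -ltr_pdivlMl//.
near: z; apply: cvgr_dist_lt; first exact: cvg_id.
by rewrite mulr_gt0// invr_gt0.
Unshelve. all: by end_near. Qed.

End Basis.
End LinearCorrespondence.

Theorem corollary1 (R : realType) (X : normedModType R) (C : set X)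
    (n : nat) (e : 'I_n -> X) (phi : X -> set X)
    (C_cone : is_cone C) (C_convex : convex_set C)
    (e_inj : injective e) (e_basis : cone_basis (range e) C)
    (phi_linear : linear_correspondence C phi) :
  (forall x, C x -> x <> 0 ->
     phi x = [set lincomb e (A *m cone_coord e x) | A in multimatrix e phi]) /\
  (forall x, C x -> lsc_at C phi x).
Proof.
split=> [x Cx x0|]; last first.
  exact: (lsc_at_cone C phi C_cone C_convex phi_linear n e e_inj e_basis).
have [v v0 xv] := (cone_lincombP e_basis x).1 Cx.
rewrite xv in x0 *; rewrite (lincombK e_inj e_basis).
rewrite (multimatrix_lincomb C phi phi_linear n e e_inj e_basis).
exact: (image_lincomb C phi C_cone C_convex phi_linear n e e_basis).
Qed.
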